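(* Let $X$ and $Y$ be finite nonempty sets and let $F: X \to 2^Y$ be a set-valued mapping. The following are equivalent: (i) $F$ is alldifferent; (ii) $F$ admits an alldifferent selection and $F(W) \cap F(X\setminus W) = \emptyset$ for every critical set $W \subset X$ of $F$; (iii) there exists a Hall partition $(W_1,\ldots,W_m)$ of $F$ such that $F^p = F$.
   Context: A set-valued mapping $F: X \to 2^Y$ assigns to each $x$ a (possibly empty) subset $F(x) \subset Y$; $F(W) = \bigcup_{x\in W}F(x)$; $\sharp$ is cardinality. A selection of $F$ is $s: X\to Y$ with $s(x)\in F(x)$ for all $x$; alldifferent means injective. The alldifferent kernel is $F^*(x) = \{y\in F(x): \exists$ alldifferent selection $s$ of $F$ with $s(x)=y\}$. $F$ is called alldifferent if $F(x)\ne\emptyset$ for all $x$ and $F^*=F$. For $W \subset X$, $F_W: X\setminus W \to 2^Y$ is $F_W(x) = F(x) \setminus F(W)$. For set-valued $G$ on a finite set, a subset $W$ of its domain is critical for $G$ if $W\ne\emptyset$ and $\sharp G(W)=\sharp W$; non-reducible for $G$ if $W\ne\emptyset$ and no proper subset of $W$ is critical for $G$. A tuple $(W_1,\ldots,W_m)$, $m\ge1$, is a Hall partition of $F$ if the $W_i$ are nonempty, pairwise disjoint with union $X$, and with $G_i = F_{W_1\cup\cdots\cup W_{i-1}}$ ($G_1=F$): (i) $G_i(x)\neq\emptyset$ for $x \in W_i$; (ii) $W_i$ is non-reducible for $G_i$; (iii) $W_i$ is critical for $G_i$ for $i \le m-1$. Given a Hall partition, $F^p(x) = G_i(x)$ for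 $x\in W_i$. *)

(* Defs.v *)
From mathcomp Require Import all_boot.

Set Implicit Arguments.
Unset Strict Implicit.
Unset Printing Implicit Defensive.

Section SetValued.
Variables X Y : finType.

(* A set-valued mapping on a subset D of X is encoded by a total function
   X -> {set Y} together with D; its values outside D are never used. *)
Implicit Types (F G : X -> {set Y}) (D W V : {set X}).

Definition image_of F W : {set Y} := \bigcup_(x in W) F x.

Definition selection F (s : X -> Y) : bool := [forall x, s x \in F x].

Definition alldiff_selection F (s : X -> Y) : bool :=
  selection F s && injectiveb s.

Definition kernel F (x : X) : {set Y} :=
  [set y in F x |
    [exists s : {ffun X -> Y}, alldiff_selection F s && (s x == y)]].

Definition alldifferent F : Prop :=
  (forall x, F x != set0) /\ kernel F =1 F.

(* F_W, whose domain is ~: W. *)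
Definition remove F W (x : X) : {set Y} := F x :\: image_of F W.

Definition critical D G W : Prop :=
  [/\ W \subset D, W != set0 & #|image_of G W| = #|W|].

Definition non_reducible D G W : Prop :=
  [/\ W \subset D, W != set0 &
      forall V, V \proper W -> ~ critical D G V].

Section Partition.
Variables (F : X -> {set Y}) (m : nat) (W : 'I_m -> {set X}).

(* Indices start at 0: [before i] is the union of the blocks strictly
   preceding block i, and [stage i] is G_(i+1), with domain ~: before i. *)
Definition before (i : 'I_m) : {set X} := \bigcup_(j < m | j < i) W j.

Definition stage (i : 'I_m) : X -> {set Y} := remove F (before i).

Record Hall_partition : Prop := HallPartition {
  hall_length : 0 < m;
  hall_nonempty : forall i, W i != set0;
  hall_disjoint : forall i j, i != j -> [disjoint W i & W j];
  hall_cover : \bigcup_i W i = [set: X];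
  hall_values : forall i x, x \in W i -> stage i x != set0;
  hall_non_reducible : forall i, non_reducible (~: before i) (stage i) (W i);
  hall_critical :
    forall i : 'I_m, i.+1 < m -> critical (~: before i) (stage i) (W i)
}.

(* F^p; when W is a Hall partition the index i below exists and is unique. *)
Definition Hall_map (x : X) : {set Y} :=
  if [pick i | x \in W i] is Some i then stage i x else set0.

End Partition.
End SetValued.

(* Main.v *)
Require Import Defs.
From mathcomp Require Import all_boot.

(** Hall's theorem (by Rado's deletion argument) reduces the existence of
    alldifferent selections to the counting condition [#|W| <= #|F(W)|].
    If critical sets have images disjoint from the images of their
    complements, imposing the value [y] at [x] keeps that condition, because
    no critical set avoiding [x] can use [y]; hence every value lies in the
    kernel.  A Hall partition is obtained by splitting off minimal critical
    sets one after the other: their images being disjoint from everything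
    else, no value is ever removed.  Conversely, a partition with [F^p = F] has
    blocks with pairwise disjoint images, so a set is critical for [F] only if
    its trace on each block is empty or critical, i.e. if it is a union of
    blocks. *)

Set Implicit Arguments.
Unset Strict Implicit.
Unset Printing Implicit Defensive.

Section Images.
Variables X Y : finType.
Implicit Types (F G : X -> {set Y}) (A B D V W : {set X}).

(** * Images of subsets *)

Lemma image_ofP F W y :
  reflect (exists2 x, x \in W & y \in F x) (y \in image_of F W).
Proof. exact: bigcupP. Qed.

Lemma image_ofU F A B :
  image_of F (A :|: B) = image_of F A :|: image_of F B.
Proof. exact: bigcup_setU. Qed.

Lemma image_of1 F x : image_of F [set x] = F x.
Proof. exact: big_set1. Qed.

Lemma image_of0 F : image_of F set0 = set0.
Proof. exact: big_set0. Qed.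

Lemma image_ofS F A B : A \subset B -> image_of F A \subset image_of F B.
Proof.
move=> /subsetP sAB; apply/subsetP=> y /image_ofP[x xA yF].
by apply/image_ofP; exists x; rewrite ?sAB.
Qed.

Lemma eq_image_of F G A :
  (forall x, x \in A -> F x = G x) -> image_of F A = image_of G A.
Proof. exact: eq_bigr. Qed.

Lemma image_of_disjointP F A B :
  reflect (forall a b y, a \in A -> b \in B -> y \in F a -> y \in F b -> False)
          (image_of F A :&: image_of F B == set0).
Proof.
apply: (iffP eqP) => [AB0 a b y aA bB ya yb | AB0].
  have : y \in image_of F A :&: image_of F B.
    by rewrite inE; apply/andP; split; apply/image_ofP; [exists a | exists b].
  by rewrite AB0 inE.
apply/setP=> y; rewrite !inE; apply/negP.
by case/andP=> /image_ofP[a aA ya] /image_ofP[b bB yb]; apply: (AB0 a b y).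
Qed.

(** * Hall's marriage theorem *)

Definition Hall_condition F := forall W, #|W| <= #|image_of F W|.

Lemma alldiff_selectionP F (s : X -> Y) :
  reflect ((forall x, s x \in F x) /\ injective s) (alldiff_selection F s).
Proof.
apply: (iffP andP) => [[/forallP sF /injectiveP]|[sF /injectiveP]] //.
by split=> //; apply/forallP.
Qed.

Lemma selection_image_sub F (s : X -> Y) W :
  (forall x, s x \in F x) -> s @: W \subset image_of F W.
Proof.
move=> sF; apply/subsetP=> _ /imsetP[x xW ->].
by apply/image_ofP; exists x.
Qed.

Lemma selection_Hall_condition F (s : X -> Y) :
  alldiff_selection F s -> Hall_condition F.
Proof.
case/alldiff_selectionP=> sF s_inj W.
by rewrite -(card_imset _ s_inj) subset_leq_card ?selection_image_sub.
Qed.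

Definition delete F x y : X -> {set Y} :=
  fun z => if z == x then F x :\ y else F z.

Lemma image_of_delete F x y W :
  x \in W -> image_of (delete F x y) W = image_of F (W :\ x) :|: (F x :\ y).
Proof.
move=> xW; rewrite -{1}(setD1K xW) image_ofU image_of1 setUC /delete eqxx.
congr (_ :|: _); apply: eq_image_of => z.
by rewrite !inE => /andP[/negPf->].
Qed.

Lemma image_of_delete_notin F x y W :
  x \notin W -> image_of (delete F x y) W = image_of F W.
Proof.
move=> xW; apply: eq_image_of => z zW; rewrite /delete.
by case: eqP zW => // ->; rewrite (negPf xW).
Qed.

(** Deletion changes only the value set at [x], so a violating set must contain [x]. Taking [x] out
    of it turns the strict inequality into a weak one. *)
Lemma delete_violation F x y :
    Hall_condition F ->
    ~~ [forall W : {set X}, #|W| <= #|image_of (delete F x y) W|] ->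
  exists2 A : {set X}, x \notin A & #|image_of F A :|: (F x :\ y)| <= #|A|.
Proof.
move=> hallF; rewrite negb_forall => /existsP[W]; rewrite -ltnNge => ltW.
have [xW|xW] := boolP (x \in W); last first.
  by move: ltW; rewrite image_of_delete_notin // ltnNge hallF.
exists (W :\ x); first by rewrite !inE eqxx.
by move: ltW; rewrite image_of_delete // (cardsD1 x W) xW.
Qed.

(* Submodularity of [W |-> #|F(W)|]: two violating sets, for [y1] and for
   [y2], would together violate the condition for [F] itself. *)
Lemma Hall_condition_delete F x y1 y2 :
    Hall_condition F -> y1 \in F x -> y2 \in F x -> y1 != y2 ->
  exists2 y, y \in F x & Hall_condition (delete F x y).
Proof.
move=> hallF y1F y2F ne12.
have [/forallP h1|/(delete_violation hallF)[A xA leA]] :=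
  boolP [forall W : {set X}, #|W| <= #|image_of (delete F x y1) W|].
  by exists y1.
have [/forallP h2|/(delete_violation hallF)[B xB leB]] :=
  boolP [forall W : {set X}, #|W| <= #|image_of (delete F x y2) W|].
  by exists y2.
pose P := image_of F A :|: (F x :\ y1); pose Q := image_of F B :|: (F x :\ y2).
(* Since [y1 != y2], each value of [F x] survives in [P] or in [Q]. The point [x], outside both [A]
   and [B], then supplies the extra unit that makes the inequality for the union strict. *)
have PUQ : image_of F (x |: (A :|: B)) \subset P :|: Q.
  rewrite !image_ofU image_of1; apply/subsetP=> y; rewrite !inE.
  have [->|_] := eqVneq y y1; first by rewrite y1F ne12 !orbT.
  by case: (y \in F x); case: (y \in image_of F A); rewrite ?orbT //= => ->.
have PIQ : image_of F (A :&: B) \subset P :&: Q.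
  by rewrite subsetI !(subset_trans (image_ofS _ _) (subsetUl _ _)) ?subsetIl
             ?subsetIr.
have := leq_add leA leB; rewrite -(cardsUI P Q) -(cardsUI A B) leqNgt.
case/negP; rewrite -addSn; apply: leq_add.
  apply: leq_trans (subset_leq_card PUQ); apply: leq_trans (hallF _).
  by rewrite cardsU1 inE negb_or xA xB.
exact: leq_trans (hallF _) (subset_leq_card PIQ).
Qed.

(** Induction on the total size of the value sets, which each deletion lowers. Once they are all
    singletons, the condition on pairs makes these singletons distinct. *)
Theorem Hall_marriage F :
  Hall_condition F -> exists s : {ffun X -> Y}, alldiff_selection F s.
Proof.
have [n] := ubnP (\sum_x #|F x|); elim: n F => // n IHn F.
rewrite ltnS => leFn hallF.
have [/forallP le1|] := boolP [forall x, #|F x| <= 1].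
  have F1 x : #|F x| == 1.
    by rewrite eqn_leq le1 -(image_of1 F) -(cards1 x) hallF.
  have [s sE] : exists s : {ffun X -> Y}, forall x, F x = [set s x].
    have [f fE] := fin_all_exists (fun x => cards1P (F1 x)).
    by exists (finfun f) => x; rewrite ffunE.
  exists s; apply/alldiff_selectionP; split=> [x|x z eqs].
    by rewrite sE set11.
  apply/eqP; apply/negPn/negP => ne_xz.
  have := hallF [set x; z].
  by rewrite image_ofU !image_of1 !sE eqs setUid cards1 cards2 ne_xz.
rewrite negb_forall => /existsP[x].
rewrite -ltnNge => /card_gt1P[y1 [y2 [y1F y2F ne]]].
have [y yF hallG] := Hall_condition_delete hallF y1F y2F ne.
have [|s /alldiff_selectionP[sG s_inj]] := IHn _ _ hallG.
  apply: leq_trans leFn; rewrite (bigD1 x) //= [ltnRHS](bigD1 x) //= -addSn.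
  rewrite {1}/delete eqxx (cardsD1 y (F x)) yF leq_add2l leq_sum // => z zx.
  by rewrite /delete (negPf zx).
exists s; apply/alldiff_selectionP; split=> // z.
have := sG z; rewrite /delete; case: eqP => // ->.
by rewrite inE => /andP[].
Qed.

(** * Kernel values and critical sets *)

Definition separated F :=
  forall W, critical [set: X] F W -> image_of F W :&: image_of F (~: W) = set0.

(** By counting, an alldifferent selection maps a critical [W] onto all of [F(W)]. None of these
    values is left for a point outside [W], yet equality with the kernel would provide such a
    selection. *)
Lemma alldifferent_separated F : alldifferent F -> separated F.
Proof.
case=> _ kerF W [_ _ cardW]; apply/eqP/image_of_disjointP => a x y aW.
rewrite inE => xW ya; rewrite -kerF inE => /andP[_].
case/existsP=> s /andP[/alldiff_selectionP[sF s_inj] /eqP sx].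
have sWE : s @: W = image_of F W.
  by apply/eqP; rewrite eqEcard selection_image_sub // cardW card_imset /=.
have : y \in s @: W by rewrite sWE; apply/image_ofP; exists a.
by case/imsetP=> z zW; rewrite -sx => /s_inj xz; rewrite xz zW in xW.
Qed.

(** For [y] in [F x], its alldifferent selections are those of [F] that take the value [y] at
    [x]. *)
Definition force F x y : X -> {set Y} :=
  fun z => if z == x then [set y] else F z :\ y.

Lemma image_of_force F x y W :
  x \notin W -> image_of (force F x y) W = image_of F W :\ y.
Proof.
move=> xW; apply/setP=> w; rewrite in_setD1; apply/image_ofP/andP.
  case=> z zW; rewrite /force; case: eqP zW => [->|_ zW].
    by rewrite (negPf xW).
  by rewrite in_setD1 => /andP[wy wF]; split=> //; apply/image_ofP; exists z.
case=> wy /image_ofP[z zW wF]; exists z => //; rewrite /force.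
by case: eqP zW => [->|_ _]; rewrite ?(negPf xW) // in_setD1 wy.
Qed.

Lemma Hall_condition_force F x y :
  Hall_condition F -> separated F -> y \in F x -> Hall_condition (force F x y).
Proof.
move=> hallF sepF yF.
(* Removing [y] costs at most one element, so only a critical [V] whose image contains [y] could
   fail. Separation excludes it, as [y] is also a value at [x]. *)
have avoid V : x \notin V -> #|V| <= #|image_of F V :\ y|.
  move=> xV; have [yV|yV] := boolP (y \in image_of F V); last first.
    by have := hallF V; rewrite (cardsD1 y (image_of F V)) (negPf yV).
  rewrite -ltnS.
  have -> : #|image_of F V :\ y|.+1 = #|image_of F V|.
    by rewrite [RHS](cardsD1 y) yV.
  rewrite ltn_neqAle hallF andbT; apply/negP=> /eqP cardV.
  have /image_ofP[z zV yz] := yV.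
  have critV : critical [set: X] F V.
    by split=> //; apply/set0Pn; exists z.
  have /eqP/image_of_disjointP := sepF _ critV.
  by move=> /(_ z x y zV); rewrite inE xV => /(_ isT yz yF).
move=> W; have [xW|xW] := boolP (x \in W); last first.
  by rewrite image_of_force // avoid.
(* The point [x] contributes exactly [y], which is absent from the rest of the image: both sides
   grow by one. *)
have xW' : x \notin W :\ x by rewrite !inE eqxx.
rewrite -(setD1K xW) image_ofU image_of1 image_of_force // {1}/force eqxx.
by rewrite !cardsU1 xW' !inE eqxx /= leq_add2l avoid.
Qed.

Lemma separated_alldifferent F (s : X -> Y) :
  alldiff_selection F s -> separated F -> alldifferent F.
Proof.
move=> s_sel sepF; have hallF := selection_Hall_condition s_sel.
case/alldiff_selectionP: s_sel => sF _; split=> x.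
  by apply/set0Pn; exists (s x).
apply/setP=> y; rewrite inE; apply: andb_idr => yF.
have [t /alldiff_selectionP[tG t_inj]] :=
  Hall_marriage (Hall_condition_force hallF sepF yF).
have tx : t x = y by apply/set1P; have := tG x; rewrite /force eqxx.
apply/existsP; exists t; rewrite tx eqxx andbT.
apply/alldiff_selectionP; split=> // z.
have := tG z; rewrite /force; case: eqP => [->|_]; first by rewrite tx.
by rewrite inE => /andP[].
Qed.

(** * Critical and non-reducible sets *)

Lemma eq_critical D F G V :
    (forall x, x \in D -> F x = G x) -> critical D F V -> critical D G V.
Proof.
move=> eqFG [sVD V0 cardV]; split=> //; rewrite -cardV; congr #|pred_of_set _|.
by apply: eq_image_of => x xV; rewrite eqFG ?(subsetP sVD).
Qed.

(** Induction on [#|V|]: for [V] without one point the bound holds, and it is strict because this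
    proper subset of [W] is not critical. The slack pays for the missing point. *)
Lemma Hall_condition_non_reducible D G W :
    (forall x, x \in W -> G x != set0) -> non_reducible D G W ->
  forall V, V \subset W -> #|V| <= #|image_of G V|.
Proof.
move=> G0 [sWD _ nred] V.
have [n] := ubnP #|V|; elim: n V => // n IHn V; rewrite ltnS => leVn sVW.
have [->|[x xV]] := set_0Vmem V; first by rewrite cards0.
have xW : x \in W := subsetP sVW x xV.
have prV : V :\ x \proper V by rewrite properD1.
have sV : V :\ x \subset W := subset_trans (proper_sub prV) sVW.
(* The empty set is never critical and yields no slack, so singletons rely on [G x] being
   nonempty. *)
have [V0|V0] := eqVneq (V :\ x) set0.
  rewrite -(setD1K xV) V0 setU0 image_of1 cards1 card_gt0.
  exact: G0.
have leV : #|V :\ x| <= #|image_of G (V :\ x)|.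
  by apply: IHn => //; apply: leq_trans leVn; apply: proper_card.
have ltV : #|V :\ x| < #|image_of G (V :\ x)|.
  rewrite ltn_neqAle leV andbT; apply/negP=> /eqP eqV.
  apply: (nred (V :\ x)); first exact: proper_sub_trans prV sVW.
  by split=> //; apply: subset_trans sV sWD.
rewrite (cardsD1 x V) xV; apply: leq_trans ltV _.
by rewrite subset_leq_card ?image_ofS ?subsetDl.
Qed.

(** * From a Hall partition to separated critical sets *)

Section FromPartition.
Variables (F : X -> {set Y}) (m : nat) (W : 'I_m -> {set X}).
Hypotheses (partW : Hall_partition F W) (mapW : Hall_map F W =1 F).

Lemma block_inj i j x : x \in W i -> x \in W j -> i = j.
Proof.
move=> xi xj; apply/eqP/negPn/negP=> /(hall_disjoint partW).
by move=> /disjoint_setI0/setP/(_ x); rewrite !inE xi xj.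
Qed.

Lemma mem_block x : exists i, x \in W i.
Proof.
have : x \in \bigcup_i W i by rewrite (hall_cover partW) inE.
by case/bigcupP=> i _; exists i.
Qed.

Lemma stage_block i x : x \in W i -> stage F W i x = F x.
Proof.
move=> xi; rewrite -[RHS]mapW /Hall_map; case: pickP => [j xj|/(_ i)].
  by rewrite (block_inj xi xj).
by rewrite xi.
Qed.

(** The stage of the later block omits every value used by earlier blocks, and by [mapW] it still
    equals [F] there. *)
Lemma block_image_disjoint i j a b y :
  a \in W i -> b \in W j -> y \in F a -> y \in F b -> i = j.
Proof.
have early (k l : 'I_m) c d : k < l -> c \in W k -> d \in W l -> y \in F c ->
    y \notin F d.
  move=> ltkl ck dl yc; rewrite -(stage_block dl) !inE negb_and negbK.
  apply/orP; left; apply/image_ofP; exists c => //.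
  by apply/bigcupP; exists k.
move=> ai bj ya yb; have [lt|lt|/val_inj//] := ltngtP i j.
  by move: yb; rewrite (negPf (early _ _ _ _ lt ai bj ya)).
by move: ya; rewrite (negPf (early _ _ _ _ lt bj ai yb)).
Qed.

Lemma card_trace V : #|V| = \sum_i #|V :&: W i|.
Proof.
rewrite -sum1_card -[in LHS](setIT V) -(hall_cover partW) big_distrr /=.
rewrite partition_disjoint_bigcup.
  by apply: eq_bigr => i _; rewrite sum1_card.
move=> i j /(hall_disjoint partW); apply: disjointW; exact: subsetIr.
Qed.

Lemma card_image_trace V :
  #|image_of F V| = \sum_i #|image_of F (V :&: W i)|.
Proof.
have -> : image_of F V = \bigcup_i image_of F (V :&: W i).
  apply/setP=> y; apply/image_ofP/bigcupP => [[x xV yF]|[i _]].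
    have [i xi] := mem_block x; exists i => //.
    by apply/image_ofP; exists x; rewrite // inE xV.
  by case/image_ofP=> x /setIP[xV _] yF; exists x.
rewrite -sum1_card partition_disjoint_bigcup.
  by apply: eq_bigr => i _; rewrite sum1_card.
move=> i j ne_ij; rewrite -setI_eq0; apply/image_of_disjointP => a b y.
move=> /setIP[_ ai] /setIP[_ bj] ya yb.
by rewrite (block_image_disjoint ai bj ya yb) eqxx in ne_ij.
Qed.

Lemma image_of_stage i V :
  V \subset W i -> image_of (stage F W i) V = image_of F V.
Proof. by move=> /subsetP sVW; apply: eq_image_of => x /sVW/stage_block. Qed.

Lemma card_trace_leq V i : #|V :&: W i| <= #|image_of F (V :&: W i)|.
Proof.
rewrite -(image_of_stage (subsetIr V (W i))).
apply: (Hall_condition_non_reducible (W := W i) _ (hall_non_reducible partW i)).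
  exact: hall_values partW i.
exact: subsetIr.
Qed.

Lemma partition_Hall_condition : Hall_condition F.
Proof.
by move=> V; rewrite card_trace card_image_trace leq_sum // => i _;
   apply: card_trace_leq.
Qed.

Lemma critical_trace V i :
  critical [set: X] F V -> V :&: W i != set0 -> W i \subset V.
Proof.
case=> _ _ cardV ne0; have [sWD _ nred] := hall_non_reducible partW i.
have eq_tr : #|V :&: W i| = #|image_of F (V :&: W i)|.
  (* The sizes of [V] and of its image are sums over the blocks of termwise ordered quantities;
     equality of the sums forces equality in every term. *)
  have := leqif_sum (fun j (_ : true) =>
    leqif_geq (card_trace_leq V j) : _ <= _ ?= iff _).
  rewrite -card_trace -card_image_trace cardV => /leqifP.
  case: forallP => [/(_ i) /= ge _|_]; last by rewrite ltnn.
  by apply/eqP; rewrite eqn_leq card_trace_leq.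
apply/setIidPr/eqP; rewrite eqEsubset subsetIr /=; apply/negPn/negP=> nsub.
(* Otherwise the trace would be a critical proper subset of a non-reducible block. *)
apply: (nred (V :&: W i)); first by rewrite properE subsetIr nsub.
split=> //; first by rewrite (subset_trans (subsetIr _ _)).
by rewrite image_of_stage ?subsetIr.
Qed.

Lemma partition_separated : separated F.
Proof.
move=> V critV; apply/eqP/image_of_disjointP => a b y aV.
rewrite inE => bV ya yb; have [i ai] := mem_block a; have [j bj] := mem_block b.
have eij := block_image_disjoint ai bj ya yb; rewrite -{j}eij in bj.
have /subsetP/(_ b bj) : W i \subset V.
  by apply: critical_trace => //; apply/set0Pn; exists a; rewrite inE aV.
by rewrite (negPf bV).
Qed.

End FromPartition.

(** * From separated critical sets to a Hall partition *)

Section ToPartition.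
Variable F : X -> {set Y}.
Hypothesis sepF : separated F.

(** The boolean form lets minimal critical sets be taken with [minset]. *)
Definition criticalb W := (W != set0) && (#|image_of F W| == #|W|).

Lemma criticalP D W :
  W \subset D -> reflect (critical D F W) (criticalb W).
Proof.
by move=> sWD; apply: (iffP andP) => [[? /eqP]|[_ ? /eqP]].
Qed.

Definition closed_block W :=
  image_of F W :&: image_of F (~: W) = set0 /\ non_reducible [set: X] F W.

(** Strong induction on [#|D|]. The disjointness assumption on [D] is the invariant that passes to
    what remains after a block is split off. Only the last block may fail to be critical. *)
Lemma separated_blocks D :
    D != set0 -> image_of F D :&: image_of F (~: D) = set0 ->
  exists ws : seq {set X},
    [/\ 0 < size ws,
        pairwise (fun A B => [disjoint A & B]) ws,
        \bigcup_(A <- ws) A = D,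
        forall A, A \in ws -> closed_block A &
        forall i, i.+1 < size ws -> critical [set: X] F (nth set0 ws i)].
Proof.
have [n] := ubnP #|D|; elim: n D => // n IHn D; rewrite ltnS => leDn D0 clD.
have [/existsP[V0 cV0]|noV] :=
  boolP [exists V : {set X}, criticalb V && (V \proper D)]; last first.
  exists [:: D]; split=> //; first by rewrite big_seq1.
  move=> A; rewrite inE => /eqP->; split=> //; split=> // V pVD critV.
  case/existsP: noV; exists V; rewrite pVD andbT.
  exact/(criticalP (subsetT V)).
have [V minV _] :=
  minset_exists (P := fun V => criticalb V && (V \proper D)) cV0.
have /andP[cV pVD] := minsetp minV.
have critV : critical [set: X] F V by apply/criticalP.
have sVD := proper_sub pVD.
have V_red : non_reducible [set: X] F V.
  split=> // [|U pUV critU]; first by case/andP: cV.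
  have := minsetinf minV _ (proper_sub pUV).
  rewrite (sub_proper_trans (proper_sub pUV) pVD) andbT.
  by move=> /(_ (introT (criticalP (subsetT U)) critU)) eqUV;
     rewrite eqUV properxx in pUV.
have clV := sepF critV.
(* A point outside [D :\: V] lies in [V] or outside [D]; [clV] settles the first case and [clD] the
   second. *)
have clR : image_of F (D :\: V) :&: image_of F (~: (D :\: V)) = set0.
  apply/eqP/image_of_disjointP => a b y; rewrite !inE negb_and negbK.
  case/andP=> aV aD /orP[bV|bD] ya yb.
    by move/eqP/image_of_disjointP: clV => /(_ b a y bV); rewrite inE aV; auto.
  by move/eqP/image_of_disjointP: clD => /(_ a b y aD); rewrite inE bD; auto.
have [||ws [ws0 dis cov clos crit]] := IHn (D :\: V) _ _ clR.
- apply: leq_trans leDn; rewrite -(cardsID V D) -[ltnLHS]add0n ltn_add2r.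
  by rewrite (setIidPr sVD) card_gt0; case/andP: cV.
- by rewrite setD_eq0; case/andP: pVD.
exists (V :: ws); split=> //=.
- rewrite dis andbT; apply/allP=> A Aws; rewrite disjoint_sym.
  have : A \subset D :\: V by rewrite -cov (big_rem A) //= subsetUl.
  by rewrite subsetD => /andP[].
- by rewrite big_cons cov -{1}(setIidPr sVD) setID.
- by move=> A; rewrite inE => /orP[/eqP->|/clos].
- by case=> [|i] //=; rewrite ltnS => /crit.
Qed.

Lemma separated_partition :
  0 < #|X| -> (forall x, F x != set0) ->
  exists (m : nat) (W : 'I_m -> {set X}),
    Hall_partition F W /\ Hall_map F W =1 F.
Proof.
move=> X0 F0.
have [||ws [ws0 dis cov clos crit]] := @separated_blocks [set: X].
- by rewrite -card_gt0 cardsT.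
- by rewrite setCT image_of0 setI0.
pose W (i : 'I_(size ws)) := nth set0 ws i.
have wsW i : W i \in ws by apply: mem_nth.
have disW i j : i != j -> [disjoint W i & W j].
  have lt (k l : 'I_(size ws)) : k < l -> [disjoint W k & W l].
    by move=> ltkl; apply: (pairwiseP set0 dis); rewrite ?inE ?ltn_ord.
  by rewrite -val_eqE neq_ltn => /orP[/lt|/lt] //; rewrite disjoint_sym.
have covW : \bigcup_i W i = [set: X].
  by rewrite -cov [RHS](big_nth set0) big_mkord.
(* Each earlier block shares no value with its complement, so removing its image takes nothing from
   [F x]. This lets properties of [F] on [X] pass to the stages. *)
have stageE i x : x \notin before W i -> stage F W i x = F x.
  move=> xb; apply/setDidPl; rewrite -setI_eq0 -image_of1 setIC.
  apply/image_of_disjointP=> a b y /bigcupP[j ltji aj] /set1P-> ya yx.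
  have [/eqP/image_of_disjointP clj _] := clos _ (wsW j).
  apply: (clj a x y) => //; rewrite inE; apply: contra xb => xj.
  by apply/bigcupP; exists j.
have Wnb i : W i \subset ~: before W i.
  rewrite subsetC; apply/bigcupsP=> j ltji; rewrite -disjoints_subset.
  by apply: disW; rewrite -val_eqE neq_ltn ltji.
have stageW i x : x \in W i -> stage F W i x = F x.
  by move=> /(subsetP (Wnb i)); rewrite inE => /stageE.
exists (size ws), W; split; last first.
  move=> x; rewrite /Hall_map; case: pickP => [i /stageW //|nox].
  have : x \in \bigcup_i W i by rewrite covW inE.
  by case/bigcupP=> i _; rewrite nox.
split=> //.
- by move=> i; have [_ []] := clos _ (wsW i).
- by move=> i x /stageW->.
- move=> i; have [_ [_ W0 nred]] := clos _ (wsW i); split=> // V pVW critV.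
  apply: (nred V pVW).
  have [_ V0 cardV] : critical (~: before W i) F V.
    by apply: eq_critical critV => x; rewrite inE => /stageE.
  by split.
- move=> i /crit[_ W0 cardW]; apply: (@eq_critical _ F).
    by move=> x; rewrite inE => /stageE.
  by split.
Qed.

End ToPartition.
End Images.

Theorem theorem5p1 (X Y : finType) (hX : 0 < #|X|) (hY : 0 < #|Y|)
    (F : X -> {set Y}) :
  let cond_i := alldifferent F in
  let cond_ii :=
    (exists s : {ffun X -> Y}, alldiff_selection F s) /\
    (forall W : {set X}, critical [set: X] F W ->
       image_of F W :&: image_of F (~: W) = set0) in
  let cond_iii :=
    exists (m : nat) (W : 'I_m -> {set X}),
      Hall_partition F W /\ Hall_map F W =1 F in
  (cond_i <-> cond_ii) /\ (cond_ii <-> cond_iii).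
Proof.
move=> cond_i cond_ii cond_iii; split; split.
- move=> adF; split; last exact: alldifferent_separated.
  have [F0 kerF] := adF; have [x _] := card_gt0P hX.
  have /set0Pn[y] := F0 x; rewrite -kerF inE => /andP[_ /existsP[s]].
  by case/andP=> s_sel _; exists s.
- by case=> [[s s_sel] sepF]; apply: separated_alldifferent s_sel sepF.
- case=> [[s /alldiff_selectionP[sF _]] sepF].
  by apply: separated_partition => // x; apply/set0Pn; exists (s x).
- case=> m [W [partW mapW]]; split; last exact: partition_separated partW mapW.
  exact: Hall_marriage (partition_Hall_condition partW mapW).
Qed.
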